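(* Let $n\in\mathbb{N}$ and $\varphi\in\mathcal{D}_n$. Then $\varphi\in\mathcal{P}_n$ if and only if $\varphi\,\tau_{n,1}=\varphi$.
   Context: $K$ is a field of characteristic $0$. Permutations act on the right ($i\pi$ is the image of $i$) and products $\pi\sigma$ in $S_n$ are read from left to right (first $\pi$, then $\sigma$). For $\pi\in S_n$: $\mathrm{Des}(\pi)=\{1\le i\le n-1\mid i\pi>(i+1)\pi\}$, $\mathrm{Peak}(\pi)=\{2\le i\le n-1\mid (i-1)\pi<i\pi>(i+1)\pi\}$. $\mathcal{D}_n$ is the $K$-linear span in $KS_n$ of the elements $\sum_{\mathrm{Des}(\pi)=D}\pi$, $D\subseteq\{1,\ldots,n-1\}$; $\mathcal{P}_n$ is the $K$-linear span of the elements $\sum_{\mathrm{Peak}(\pi)=P}\pi$, $P\subseteq\{2,\ldots,n-1\}$. For $n\ge2$, $\tau_{n,1}\in S_n$ is the transposition swapping $1$ and $2$; $\tau_{1,1}$ is the identity of $S_1$. *)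

(* Defs.v *)
From HB Require Import structures.
From mathcomp Require Import all_boot all_order all_algebra all_fingroup.

Set Implicit Arguments.
Unset Strict Implicit.
Unset Printing Implicit Defensive.

Import GRing.Theory.
Local Open Scope ring_scope.

(* The alias is needed because {ffun gT -> K} already carries the pointwise
   product canonically; here the product is convolution. *)
Definition grpalg (K : fieldType) (gT : finGroupType) : Type :=
  {ffun gT -> K^o}.

HB.instance Definition _ (K : fieldType) (gT : finGroupType) :=
  Vector.copy (grpalg K gT) {ffun gT -> K^o}.

Section GroupAlgebra.
Variables (K : fieldType) (gT : finGroupType).
Implicit Types (f g h : grpalg K gT) (x y : gT).

Definition ga_elt x : grpalg K gT := [ffun y => ((y == x)%:R : K^o)].

Definition ga_mul f g : grpalg K gT :=
  [ffun x => (\sum_y f y * g (y^-1 * x)%g : K^o)].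

Fact ga_mulA : associative ga_mul.
Proof.
move=> f g h; apply/ffunP=> x; rewrite !ffunE.
under eq_bigr => y _ do rewrite ffunE big_distrr /=.
under [RHS]eq_bigr => z _ do rewrite ffunE big_distrl /=.
rewrite [RHS]exchange_big /=; apply: eq_bigr => y _.
rewrite [RHS](reindex_inj (mulgI y)) /=; apply: eq_bigr => z _.
by rewrite mulrA mulKg invMg mulgA.
Qed.

Fact ga_mul1r : left_id (ga_elt 1%g) ga_mul.
Proof.
move=> f; apply/ffunP=> x; rewrite ffunE (bigD1 1%g) //= big1 => [|y /negPf ny].
  by rewrite ffunE eqxx mul1r invg1 mul1g addr0.
by rewrite ffunE ny mul0r.
Qed.

Fact ga_mulr1 : right_id (ga_elt 1%g) ga_mul.
Proof.
move=> f; apply/ffunP=> x; rewrite ffunE (bigD1 x) //= big1 => [|y /negPf ny].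
  by rewrite ffunE mulVg eqxx mulr1 addr0.
by rewrite ffunE -eq_mulVg1 ny mulr0.
Qed.

Fact ga_mulDl : left_distributive ga_mul +%R.
Proof.
move=> f g h; apply/ffunP=> x; rewrite !ffunE -big_split /=.
by apply: eq_bigr => y _; rewrite ffunE mulrDl.
Qed.

Fact ga_mulDr : right_distributive ga_mul +%R.
Proof.
move=> f g h; apply/ffunP=> x; rewrite !ffunE -big_split /=.
by apply: eq_bigr => y _; rewrite ffunE mulrDr.
Qed.

Fact ga_oner_neq0 : ga_elt 1%g != 0.
Proof.
by apply/eqP => /ffunP/(_ 1%g)/eqP; rewrite !ffunE eqxx oner_eq0.
Qed.

HB.instance Definition _ := GRing.Zmodule_isNzRing.Build (grpalg K gT)
  ga_mulA ga_mul1r ga_mulr1 ga_mulDl ga_mulDr ga_oner_neq0.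

Fact ga_scaleAl (a : K) f g : a *: (f * g) = (a *: f) * g.
Proof.
apply/ffunP=> x; rewrite !ffunE scaler_sumr.
by apply: eq_bigr => y _; rewrite ffunE scalerAl.
Qed.

HB.instance Definition _ :=
  GRing.Lmodule_isLalgebra.Build K (grpalg K gT) ga_scaleAl.

Fact ga_scaleAr (a : K) f g : a *: (f * g) = f * (a *: g).
Proof.
apply/ffunP=> x; rewrite !ffunE scaler_sumr.
by apply: eq_bigr => y _; rewrite ffunE scalerAr.
Qed.

HB.instance Definition _ :=
  GRing.Lalgebra_isAlgebra.Build K (grpalg K gT) ga_scaleAr.

Lemma ga_eltM x y : ga_elt x * ga_elt y = ga_elt (x * y)%g.
Proof.
apply/ffunP=> z; rewrite !ffunE (bigD1 x) //= big1 => [|t /negPf nt].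
  by rewrite !ffunE eqxx mul1r addr0 (can2_eq (mulKVg x) (mulKg x)).
by rewrite ffunE nt mul0r.
Qed.

Lemma ga_sumE f : f = \sum_x f x *: ga_elt x.
Proof.
apply/ffunP=> z; rewrite sum_ffunE (bigD1 z) //= big1 => [|t /negPf nt].
  by rewrite !ffunE eqxx addr0 /GRing.scale /= mulr1.
by rewrite !ffunE eq_sym nt scaler0.
Qed.

End GroupAlgebra.

(* The letters 1, ..., n are encoded as 0, ..., n-1 in 'I_n, for positions and
   for values alike. The product of 'S_n is already read from left to right:
   (s * t) i = t (s i), see permM. *)
Section DescentsPeaks.
Variable n : nat.

Definition Des (s : 'S_n) : {set 'I_n} :=
  [set i : 'I_n | [exists j : 'I_n, (j == i.+1 :> nat) && (s j < s i)%N]].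

Definition Peak (s : 'S_n) : {set 'I_n} :=
  [set i : 'I_n | [exists h : 'I_n, [exists j : 'I_n,
     [&& i == h.+1 :> nat, j == i.+1 :> nat,
         (s h < s i)%N & (s j < s i)%N]]]].

(* {1, ..., n-1} and {2, ..., n-1} in the shifted encoding. *)
Definition Des_range : {set 'I_n} := [set i : 'I_n | (i.+1 < n)%N].
Definition Peak_range : {set 'I_n} := [set i : 'I_n | (0 < i)%N & (i.+1 < n)%N].

Variable K : fieldType.

Definition des_sum (D : {set 'I_n}) : grpalg K 'S_n :=
  \sum_(s : 'S_n | Des s == D) ga_elt K s.

Definition peak_sum (P : {set 'I_n}) : grpalg K 'S_n :=
  \sum_(s : 'S_n | Peak s == P) ga_elt K s.

Definition descent_space : {vspace grpalg K 'S_n} :=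
  <<[seq des_sum D | D <- enum (powerset Des_range)]>>%VS.

Definition peak_space : {vspace grpalg K 'S_n} :=
  <<[seq peak_sum P | P <- enum (powerset Peak_range)]>>%VS.

End DescentsPeaks.

(* The value at n = 0 is a dummy. *)
Definition tau1 (n : nat) : 'S_n :=
  match n return 'S_n with
  | m.+2 => tperm ord0 (lift ord0 ord0)
  | _ => 1%g
  end.

(* Main.v *)
Require Import Defs.
From mathcomp Require Import all_boot all_order all_algebra all_fingroup.
From mathcomp Require Import zify.

Set Implicit Arguments.
Unset Strict Implicit.
Unset Printing Implicit Defensive.

(** Right multiplication by the transposition [tau1 n] exchanges the two
    smallest values of a permutation. This changes a descent set only if these
    values stand at adjacent positions i and i+1; then i is toggled, which
    affects no peak. Conversely, if i is the largest descent of s that is not a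
    peak, then i is the first position or i-1 is a descent, and i+1 is not a
    descent; so some u with the descents of s has its two smallest values at i
    and i+1, and exchanging them removes i from the descent set. Iterating, any
    descent set is reduced to its peak set, so an invariant function of the
    descent set depends only on the peak set. *)

Import GRing.Theory.
Local Open Scope ring_scope.

(** * Coefficients in the group algebra and spans of fibre sums *)

Lemma ga_mul_eltr (K : fieldType) (gT : finGroupType) (f : grpalg K gT)
    (x y : gT) :
  (f * ga_elt K y) x = f (x * y^-1)%g.
Proof.
rewrite ffunE (bigD1 (x * y^-1)%g) //= big1 ?addr0.
  by rewrite ffunE invMg invgK mulgKV eqxx mulr1.
move=> z nz; rewrite ffunE; case: eqP => [zxy|]; last by rewrite mulr0.
by rewrite -zxy invMg invgK mulKVg eqxx in nz.
Qed.

(** Each fibre sum is the indicator of a fibre of [F], and [Fr] ensures that every nonempty fibre is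
    listed in [r]. This turns membership in both [descent_space] and [peak_space] into a condition
    on coefficients. *)
Lemma mem_span_fibers (K : fieldType) (gT : finGroupType) (T : finType)
    (F : gT -> T) (r : seq T) (phi : grpalg K gT) :
    (forall x, F x \in r) ->
  phi \in <<[seq (\sum_(x | F x == D) ga_elt K x)%R
               | D <- r]>>%VS
  <-> (forall x y, F x = F y -> phi x = phi y).
Proof.
move=> Fr; split=> [phiS x y Fxy | phiF].
  have fibE D z : (\sum_(x | F x == D) ga_elt K x : grpalg K gT) z
      = (F z == D)%:R.
    rewrite sum_ffunE; have [FzD|FzD] := boolP (F z == D).
      rewrite (bigD1 z) //= big1 ?addr0 ?ffunE ?eqxx // => t /andP[_ /negPf nt].
      by rewrite ffunE eq_sym nt.
    rewrite big1 // => t FtD; rewrite ffunE; case: eqP => // zt.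
    by rewrite zt FtD in FzD.
  rewrite (coord_span (X := in_tuple _) phiS) !sum_ffunE.
  apply: eq_bigr => i _; rewrite !ffunE /=.
  have ltir : (i < size r)%N by rewrite -(size_map (fun D =>
    (\sum_(x | F x == D) ga_elt K x : grpalg K gT)) r).
  by rewrite (nth_map (F x)) // !fibE Fxy.
rewrite (ga_sumE phi) (partition_big F xpredT) //=.
apply: memv_suml => D _.
have [x /= /eqP FxD|noD] := pickP (fun x => F x == D); last first.
  by rewrite big_pred0 ?mem0v.
rewrite (eq_bigr (fun y => phi x *: ga_elt K y)); last first.
  by move=> y /eqP FyD; rewrite (phiF y x) // FyD.
rewrite -scaler_sumr memvZ // memv_span //.
by apply/mapP; exists D; rewrite // -FxD.
Qed.

(** * Descent sets and peak sets *)

Lemma DesP n (s : 'S_n) (i : 'I_n) :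
  reflect (exists2 j : 'I_n, j = i.+1 :> nat & (s j < s i)%N) (i \in Des s).
Proof.
rewrite inE; apply: (iffP existsP) => [[j /andP[/eqP ? ?]]|[j /eqP ? ?]].
  by exists j.
by exists j; apply/andP.
Qed.

Lemma in_Des n (s : 'S_n) (i j : 'I_n) :
  j = i.+1 :> nat -> (i \in Des s) = (s j < s i)%N.
Proof.
move=> ji; apply/DesP/idP => [[k ki]|lt_ji]; last by exists j.
by have -> : k = j by apply: val_inj; rewrite /= ki ji.
Qed.

Lemma PeakP n (s : 'S_n) (i : 'I_n) :
  reflect (exists h j : 'I_n, [/\ i = h.+1 :> nat, j = i.+1 :> nat,
             (s h < s i)%N & (s j < s i)%N])
          (i \in Peak s).
Proof.
rewrite inE; apply: (iffP existsP) => [[h /existsP[j]]|[h [j [ih ji H1 H2]]]].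
  by case/and4P=> /eqP ? /eqP ? ? ?; exists h, j.
by exists h; apply/existsP; exists j; rewrite ih ji -ih H1 H2 !eqxx.
Qed.

Lemma perm_lt_neg n (s : 'S_n) (i j : 'I_n) :
  i != j -> (s i < s j)%N = ~~ (s j < s i)%N.
Proof.
by move=> nij; rewrite -leqNgt ltn_neqAle (inj_eq val_inj) (inj_eq perm_inj) nij.
Qed.

(** Peaks are read off from the descent set alone; a descent fails to be a peak exactly when it is
    the first position or follows a descent. *)
Lemma Peak_Des n (s : 'S_n) (i : 'I_n) :
  (i \in Peak s) =
  (i \in Des s) && [exists h : 'I_n, (i == h.+1 :> nat) && (h \notin Des s)].
Proof.
apply/PeakP/andP => [[h [j [ih ji ltsh ltsj]]]|[/DesP[j ji ltsj] /existsP[h]]].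
  rewrite (in_Des s ji); split=> //.
  apply/existsP; exists h; rewrite ih eqxx (in_Des s ih) -leqNgt; exact: ltnW.
case/andP=> /eqP ih; rewrite (in_Des s ih) -perm_lt_neg => [ltsh|].
  by exists h, j.
by apply/eqP=> eq_hi; move: ih; rewrite eq_hi; lia.
Qed.

Lemma Peak_sub_Des n (s : 'S_n) : Peak s \subset Des s.
Proof. by apply/subsetP=> i; rewrite Peak_Des => /andP[]. Qed.

Lemma eq_Des_Peak n (s t : 'S_n) : Des s = Des t -> Peak s = Peak t.
Proof. by move=> eqD; apply/setP=> i; rewrite !Peak_Des eqD. Qed.

Lemma Des_in_range n (s : 'S_n) : Des s \in powerset (Des_range n).
Proof.
by rewrite inE; apply/subsetP=> i /DesP[j ji _]; rewrite inE -ji ltn_ord.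
Qed.

Lemma Peak_in_range n (s : 'S_n) : Peak s \in powerset (Peak_range n).
Proof.
rewrite inE; apply/subsetP=> i /PeakP[h [j [ih ji _ _]]].
by rewrite inE -ji ltn_ord ih.
Qed.

(** * Exchanging the two smallest values *)

Lemma tau1E n (i : 'I_n) : (1 < n)%N ->
  tau1 n i = (if i == 0 :> nat then 1 else if i == 1 :> nat then 0 else i)%N
    :> nat.
Proof.
case: n i => [|[|m]] i // _; rewrite /tau1.
case: tpermP => [->|->|/eqP n0 /eqP n1] //.
by move: n0 n1; rewrite -!val_eqE /= /bump /= => /negPf-> /negPf->.
Qed.

Lemma tau1V n : (tau1 n)^-1%g = tau1 n.
Proof. by case: n => [|[|m]]; rewrite /tau1 ?invg1 // tpermV. Qed.

(** The value at a peak exceeds two distinct values, so it is at least 2 and [tau1 n] fixes it; its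
    neighbours stay below it. One inclusion suffices because [tau1 n] is an involution. *)
Lemma Peak_mul_tau1 n (s : 'S_n) : Peak (s * tau1 n) = Peak s.
Proof.
suff sub u : Peak u \subset Peak (u * tau1 n).
  apply/eqP; rewrite eqEsubset sub andbT.
  have := sub (s * tau1 n)%g.
  by rewrite -{3}tau1V mulgK.
apply/subsetP=> i /PeakP[h [j [ih ji lth ltj]]]; apply/PeakP.
have nhj : u h != u j :> nat.
  by rewrite (inj_eq val_inj) (inj_eq perm_inj) -val_eqE /=; lia.
have n_gt1 : (1 < n)%N by have := ltn_ord j; lia.
exists h, j; split=> //; rewrite !permM !tau1E //; do ?case: eqP; lia.
Qed.

(** * Permutations with a prescribed descent set *)

Lemma rank_mono (T : finType) (key : T -> nat) (x y : T) : (key x < key y)%N ->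
  (#|[set z | (key z < key x)%N]| < #|[set z | (key z < key y)%N]|)%N.
Proof.
move=> ltxy; apply: proper_card; apply/properP; split.
  by apply/subsetP=> z; rewrite !inE => /ltn_trans; apply.
by exists x; rewrite !inE ?ltnn.
Qed.

(** Standardisation: a permutation can be specified by any injective keys whose order its values are
    to follow. *)
Lemma rank_perm n (key : 'I_n -> nat) : injective key ->
  exists s : 'S_n,
    forall i, s i = #|[set k | (key k < key i)%N]| :> nat.
Proof.
move=> key_inj.
have rank_lt i : (#|[set k | (key k < key i)%N]| < n)%N.
  rewrite -[X in (_ < X)%N]card_ord -cardsT; apply: proper_card.
  by apply/properP; split; [exact: subsetT | exists i; rewrite ?inE ?ltnn].
have rank_inj : injective (fun i => Ordinal (rank_lt i)).
  move=> i j /(congr1 val) /= eqij; apply: key_inj; apply/eqP.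
  by case: ltngtP => // /rank_mono; rewrite eqij ltnn.
by exists (perm rank_inj) => i; rewrite permE.
Qed.

(** Values 1 and 0 at [i] and [i'] force a descent into [i] and an ascent out of [i'] wherever these
    neighbours exist; the last two hypotheses say that [D] agrees. *)
Lemma perm_with_Des_and_minima n (D : {set 'I_n}) (i i' : 'I_n) :
    i' = i.+1 :> nat -> D \subset Des_range n -> i \in D -> i' \notin D ->
    (forall h : 'I_n, i = h.+1 :> nat -> h \in D) ->
  exists u : 'S_n, [/\ Des u = D, u i' = 0 :> nat & u i = 1 :> nat]%N.
Proof.
move=> i'i Drange iD i'D hD.
pose d (j : 'I_n) := #|[set k in D | (k < j)%N]|.
have d_le j : (d j <= n)%N by rewrite -[X in (_ <= X)%N]card_ord max_card.
have dS (j k : 'I_n) : k = j.+1 :> nat -> d k = (d j + (j \in D))%N.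
  move=> kj; rewrite /d (cardsD1 j) inE kj ltnSn andbT addnC.
  congr (_ + _)%N; apply: eq_card => l; rewrite !inE.
  rewrite ltnS (ltn_neqAle l j) (inj_eq val_inj).
  by case: (l == j); case: (l \in D).
(* Ordering the positions by decreasing [d], then from left to right, would
   already give descent set D; lowering the key at i' and i keeps it. *)
pose key (j : 'I_n) :=
  if j == i' then 0%N else if j == i then 1%N else ((n - d j) * n + j).+2.
have n_gt0 : (0 < n)%N by have := ltn_ord i; lia.
have key_inj : injective key.
  move=> j k; rewrite /key.
  do 4?[case: eqP => [->|_]] => //; rewrite ?i'i //; try lia.
  (* The remaining keys are two-digit numbers in base [n], so reduction modulo [n] recovers the
     position. *)
  move=> [eqk]; apply: val_inj => /=.
  have := congr1 (modn^~ n) eqk.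
  by rewrite /= !modnMDl !modn_small.
have key_step (j k : 'I_n) : k = j.+1 :> nat ->
    if j \in D then (key k < key j)%N else (key j < key k)%N.
  move=> kj; rewrite /key.
  have [ji'|ji'] := eqVneq j i'.
    rewrite ji' (negPf i'D); rewrite ji' in kj.
    have [ki|_] := eqVneq k i'; first by move: kj; rewrite ki; lia.
    by case: eqP => // ki; move: kj; rewrite ki; lia.
  have [ki'|ki'] := eqVneq k i'.
    have -> : j = i by apply: val_inj; move: kj; rewrite ki' i'i => -[].
    by rewrite iD eqxx.
  have [ji|ji] := eqVneq j i.
    by move: ki'; rewrite -val_eqE /= kj i'i ji eqxx.
  have [ki|ki] := eqVneq k i.
    by rewrite hD // -ki kj.
  have := dS _ _ kj; have := d_le k.
  have := ltn_ord j; have := ltn_ord k.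
  case: (j \in D) => ltk ltj dk dkE; rewrite dkE ?addn0 ?addn1 !ltnS.
    (* Here [d j < n], so the truncated subtraction really drops by one: the key loses [n] and gains
       only one from the position. *)
    have -> : (n - d j)%N = (n - (d j).+1).+1 by lia.
    by rewrite mulSn; lia.
  by lia.
have [u uE] := rank_perm key_inj.
have u_lt j k : (key j < key k)%N -> (u j < u k)%N by rewrite !uE => /rank_mono.
have key0 : key i' = 0%N by rewrite /key eqxx.
have nii' : i == i' = false by apply/eqP=> /(congr1 val) /=; lia.
have key1 : key i = 1%N by rewrite /key eqxx nii'.
exists u; split.
- apply/setP=> j; have [ltj|gej] := ltnP j.+1 n.
    pose k := Ordinal ltj; have kj : k = j.+1 :> nat by [].
    rewrite (in_Des u kj); have := key_step _ _ kj.
    case: (j \in D) => /u_lt // lt_jk; apply/negbTE; rewrite -leqNgt.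
    exact: ltnW.
  apply/DesP/idP => [[k kj]|jD]; first by have := ltn_ord k; lia.
  by have := subsetP Drange j jD; rewrite inE; lia.
- rewrite uE key0; apply/eqP; rewrite cards_eq0.
  by apply/eqP/setP=> k; rewrite !inE.
- rewrite uE key1; apply/eqP/cards1P; exists i'.
  apply/setP=> k; rewrite !inE -key0 -(inj_eq key_inj) key0; lia.
Qed.

Lemma Des_mul_tau1_proper n (u : 'S_n) (i i' : 'I_n) :
    i' = i.+1 :> nat -> u i' = 0%N :> nat -> u i = 1%N :> nat ->
  Des (u * tau1 n) \proper Des u.
Proof.
move=> i'i ui' ui; have n_gt1 : (1 < n)%N by have := ltn_ord i'; lia.
apply/properP; split; last first.
  by exists i; rewrite (in_Des _ i'i) ?permM ?tau1E ?ui ?ui'.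
apply/subsetP=> j /DesP[k kj]; rewrite (in_Des u kj) !permM !tau1E // => ltkj.
have njk : u j != u k :> nat.
  by rewrite (inj_eq val_inj) (inj_eq perm_inj) -val_eqE /= kj; lia.
(* Only an ascent from value 0 to value 1 could become a new descent, but it would place [i'] just
   before [i]. *)
have noti : ~~ ((u j == 0 :> nat) && (u k == 1 :> nat)).
  apply/andP=> -[/eqP uj /eqP uk].
  have ji' : j = i' by apply: (@perm_inj _ u); apply: val_inj; rewrite /= uj ui'.
  have ki : k = i by apply: (@perm_inj _ u); apply: val_inj; rewrite /= uk ui.
  by move: kj; rewrite ji' ki; lia.
by move: ltkj noti njk; do 4?[case: eqP => ?] => /=; lia.
Qed.

(** * Reduction to the peak set and the theorem *)

Lemma reduce_Des_to_Peak n (X : Type) (phi : 'S_n -> X) :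
    (forall s t, Des s = Des t -> phi s = phi t) ->
    (forall s, phi (s * tau1 n)%g = phi s) ->
  forall s, exists2 t, Des t = Peak s & phi s = phi t.
Proof.
move=> phiD phi_tau s.
have [m] := ubnP #|Des s|; elim: m s => // m IHm s /ltnSE le_m.
have [DsP|DsP] := eqVneq (Des s) (Peak s); first by exists s.
have /set0Pn[i0 i0D] : Des s :\: Peak s != set0.
  rewrite setD_eq0; apply: contraNN DsP => sub.
  by rewrite eqEsubset sub Peak_sub_Des.
have [i iDP i_max] := arg_maxnP (fun i : 'I_n => val i) i0D.
have [iD iP] : i \in Des s /\ i \notin Peak s by move/setDP: iDP.
have [i' i'i _] := DesP _ _ iD.
(* A descent at [i'] would follow the descent [i], hence be a larger non-peak descent. *)
have i'D : i' \notin Des s.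
  apply/negP=> i'D; suff /i_max : i' \in Des s :\: Peak s by rewrite /= i'i ltnn.
  rewrite inE i'D andbT Peak_Des i'D /=; apply/existsP=> -[h /andP[/eqP i'h]].
  have -> : h = i by apply: val_inj => /=; lia.
  by rewrite iD.
have hD (h : 'I_n) : i = h.+1 :> nat -> h \in Des s.
  move=> ih; apply: contraNT iP => hD; rewrite Peak_Des iD /=.
  by apply/existsP; exists h; rewrite ih eqxx.
have Drange : Des s \subset Des_range n by rewrite -powersetE Des_in_range.
have [u [Du ui' ui]] := perm_with_Des_and_minima i'i Drange iD i'D hD.
have [|t Dt phit] := IHm (u * tau1 n)%g.
  apply: leq_trans le_m; rewrite -Du.
  exact: proper_card (Des_mul_tau1_proper i'i ui' ui).
exists t; first by rewrite Dt Peak_mul_tau1 (eq_Des_Peak Du).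
by rewrite -phit phi_tau (phiD s u).
Qed.

Theorem theorem4 (K : fieldType) (charK0 : [pchar K] =i pred0)
    (n : nat) (n_gt0 : (0 < n)%N) (phi : grpalg K 'S_n)
    (phiD : phi \in descent_space n K) :
  phi \in peak_space n K <-> phi * ga_elt K (tau1 n) = phi.
Proof.
have Des_in (s : 'S_n) : Des s \in enum (powerset (Des_range n)).
  by rewrite mem_enum Des_in_range.
have Peak_in (s : 'S_n) : Peak s \in enum (powerset (Peak_range n)).
  by rewrite mem_enum Peak_in_range.
have {}phiD := proj1 (mem_span_fibers _ Des_in) phiD.
have peakE := mem_span_fibers phi Peak_in.
split=> [/(proj1 peakE) phiP | phi_tau].
  apply/ffunP=> s; rewrite ga_mul_eltr tau1V.
  exact/phiP/Peak_mul_tau1.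
apply/(proj2 peakE) => s t eqP.
have phi_inv x : phi (x * tau1 n)%g = phi x.
  by rewrite -{2}phi_tau ga_mul_eltr tau1V.
(* Both coefficients are moved to permutations whose descent set is the common peak set. *)
have [s' Ds' ->] := reduce_Des_to_Peak phiD phi_inv s.
have [t' Dt' ->] := reduce_Des_to_Peak phiD phi_inv t.
by apply: phiD; rewrite Ds' Dt'.
Qed.
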